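(* Let $P$ be a $2$-torsion free prime ring with identity $1$ that contains a non-trivial idempotent $e_1$, and let $d : P \rightarrow P$ be a commuting Jordan derivation. Then $d$ is the zero map, i.e. $d(p)=0$ for all $p\in P$.
   Context: Rings are associative and not assumed commutative. A ring $P$ is prime if $p_1 P p_2 = 0$ implies $p_1=0$ or $p_2=0$; it is $2$-torsion free if $2p=0$ with $p\in P$ implies $p=0$. An idempotent $e_1$ ($e_1^2=e_1$) is non-trivial if $e_1\neq 0$ and $e_1\neq 1$. A commuting Jordan derivation on $P$ is an additive map $d:P\to P$ such that $d(p^2)=d(p)p+pd(p)$ and $d(p)p=pd(p)$ for all $p\in P$. *)

(* Defs.v *)
From mathcomp Require Import all_boot all_algebra.

Set Implicit Arguments.
Unset Strict Implicit.
Unset Printing Implicit Defensive.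

Import GRing.Theory.
Local Open Scope ring_scope.

Definition prime_ring (P : pzRingType) : Prop :=
  forall p1 p2 : P, (forall p : P, p1 * p * p2 = 0) -> p1 = 0 \/ p2 = 0.

Definition two_torsion_free (P : pzRingType) : Prop :=
  forall p : P, p *+ 2 = 0 -> p = 0.

Definition nontrivial_idempotent (P : pzRingType) (e : P) : Prop :=
  [/\ e ^+ 2 = e, e <> 0 & e <> 1].

Definition jordan_derivation (P : pzRingType) (d : {additive P -> P}) : Prop :=
  forall p : P, d (p ^+ 2) = d p * p + p * d p.

Definition commuting (P : pzRingType) (d : P -> P) : Prop :=
  forall p : P, d p * p = p * d p.

Definition commuting_jordan_derivation (P : pzRingType)
    (d : {additive P -> P}) : Prop :=
  jordan_derivation d /\ commuting d.

(* Main.v *)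
Require Import Defs.
From mathcomp Require Import all_boot all_algebra.

(** The proof uses the Peirce decomposition
    [p = e p e + e p f + f p e + f p f] with [f = 1 - e].
    Commutation turns the Jordan identity at an idempotent [e] into
    [d e = 2 e (d e)]; multiplying by [e] gives [e (d e) = 0], so [d] kills
    every idempotent ([jordan_idem0]).  Linearizing both identities at [e] then
    shows that each value [d q] commutes with [e] and that
    [d (e q + q e) = 2 e (d q)] ([jordan_idem_anticomm]).
    - If [x] lies in an off-diagonal corner, then [e x + x e = x], so
      [d x = 2 e (d x)], and [d x = 0] exactly as for [d e]
      ([jordan_off_diagonal0]).
    - If [a] lies in [e P e], then [d a = e (d a)] because [2] can be
      cancelled, so [d a] stays in that corner.  As [d] vanishes on [e P f],
      the linearized commutation makes [d a] commute with [e P f]; but [d a]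
      in [e P e] annihilates [e P f] from the right, hence also from the left,
      and primeness forces [d a = 0] ([jordan_corner0]).
    The hypotheses on [e] are symmetric in [e] and [f], so these two cases
    cover all four corners. *)

Set Implicit Arguments.
Unset Strict Implicit.
Import GRing.Theory.
Local Open Scope ring_scope.

Lemma mulr_sum2 (P : pzRingType) (a b x y : P) :
  (a + b) * (x + y) = (a * x + b * y) + (a * y + b * x).
Proof. by rewrite mulrDl !mulrDr [b * x + _]addrC addrACA. Qed.

Lemma jordan_linear (P : pzRingType) (d : {additive P -> P}) (p q : P) :
  jordan_derivation d ->
  d (p * q + q * p) = d p * q + d q * p + (p * d q + q * d p).
Proof.
move=> dJ; apply: (addrI (d (p ^+ 2) + d (q ^+ 2))).
rewrite -!raddfD /= [LHS](_ : _ = d ((p + q) ^+ 2)); last first.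
  by rewrite !expr2 mulr_sum2.
by rewrite dJ !raddfD /= !mulr_sum2 !dJ addrACA; congr (_ + _); rewrite addrACA.
Qed.

Lemma commuting_linear (P : pzRingType) (d : {additive P -> P}) (p q : P) :
  commuting d -> d p * q + d q * p = p * d q + q * d p.
Proof.
move=> dC; have := dC (p + q).
by rewrite raddfD /= !mulr_sum2 !dC => /addrI.
Qed.

(** Multiplying [y = 2 e y] by [e] gives [e y = 2 e y], hence [e y = 0]. *)
Lemma idem_double_eq0 (P : pzRingType) (e y : P) :
  e * e = e -> y = (e * y) *+ 2 -> y = 0.
Proof.
move=> ee yE; suff ey0 : e * y = 0 by rewrite yE ey0 mul0rn.
have := congr1 ( *%R e) yE; rewrite mulrnAr mulrA ee mulr2n => E.
by apply: (addrI (e * y)); rewrite addr0 -E.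
Qed.

Lemma jordan_idem0 (P : pzRingType) (d : {additive P -> P}) (e : P) :
  commuting_jordan_derivation d -> e * e = e -> d e = 0.
Proof.
move=> [dJ dC] ee; apply: (idem_double_eq0 ee).
by rewrite -{1}ee -expr2 dJ dC mulr2n.
Qed.

Lemma jordan_idem_comm (P : pzRingType) (d : {additive P -> P}) (e q : P) :
  commuting_jordan_derivation d -> e * e = e -> d q * e = e * d q.
Proof.
move=> dCJ ee; have := commuting_linear e q (proj2 dCJ).
by rewrite (jordan_idem0 dCJ ee) mul0r mulr0 add0r addr0.
Qed.

Lemma jordan_idem_anticomm (P : pzRingType) (d : {additive P -> P}) (e q : P) :
  commuting_jordan_derivation d -> e * e = e ->
  d (e * q + q * e) = (e * d q) *+ 2.
Proof.
move=> dCJ ee; rewrite (jordan_linear e q (proj1 dCJ)).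
rewrite (jordan_idem0 dCJ ee) mul0r mulr0 add0r addr0.
by rewrite (jordan_idem_comm q dCJ ee) mulr2n.
Qed.

Lemma jordan_off_diagonal0 (P : pzRingType) (d : {additive P -> P}) (e x : P) :
  commuting_jordan_derivation d -> e * e = e -> e * x = x -> x * e = 0 ->
  d x = 0.
Proof.
move=> dCJ ee ex xe; apply: (idem_double_eq0 ee).
by rewrite -(jordan_idem_anticomm x dCJ ee) ex xe addr0.
Qed.

(** Primeness enters through [(d a) P (1 - e) = 0]: the second factor is
    nonzero, which is why [e <> 1] is required. *)
Lemma jordan_corner0 (P : pzRingType) (d : {additive P -> P}) (e a : P) :
  prime_ring P -> two_torsion_free P -> commuting_jordan_derivation d ->
  e * e = e -> e <> 1 -> e * a = a -> a * e = a -> d a = 0.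
Proof.
move=> primeP tf2 dCJ ee e1 ea ae.
have da_e : e * d a = d a.
  apply/eqP; rewrite -subr_eq0; apply/eqP; apply: tf2.
  by rewrite mulrnBl -(jordan_idem_anticomm a dCJ ee) ea ae raddfD -mulr2n subrr.
have fe : (1 - e) * e = 0 by rewrite mulrBl mul1r ee subrr.
have [//|f0] : d a = 0 \/ 1 - e = 0.
  apply: primeP => p; set x := e * (p * (1 - e)).
  have xe : x * e = 0 by rewrite /x -!mulrA fe !mulr0.
  have dx : d x = 0.
    by apply: (jordan_off_diagonal0 dCJ ee _ xe); rewrite /x mulrA ee.
  have := commuting_linear a x (proj2 dCJ).
  (* [x (d a) = x e (d a) = 0] *)
  rewrite dx mul0r mulr0 addr0 add0r -{2}da_e (mulrA x) xe mul0r.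
  by rewrite /x mulrA (jordan_idem_comm a dCJ ee) da_e mulrA.
by case: e1; apply/esym/eqP; rewrite -subr_eq0 f0.
Qed.

Unset Implicit Arguments.
Set Strict Implicit.

Theorem corollary2p7 (P : pzRingType) (e1 : P) (d : {additive P -> P})
    (hP : prime_ring P) (hP2 : two_torsion_free P)
    (he1 : nontrivial_idempotent e1)
    (hd : commuting_jordan_derivation d) :
  forall p : P, d p = 0.
Proof.
move=> p; case: he1; rewrite expr2 => ee e0 e1N.
pose f := 1 - e1.
have ef : e1 * f = 0 by rewrite mulrBr mulr1 ee subrr.
have fe : f * e1 = 0 by rewrite mulrBl mul1r ee subrr.
have ff : f * f = f by rewrite {2}/f mulrBr mulr1 fe subr0.
have f1 : f <> 1.
  by move=> fE; apply: e0; rewrite -[LHS]mul1r -fE fe.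
have ef1 : e1 + f = 1 by rewrite addrC subrK.
have -> : p = e1 * p * e1 + e1 * p * f + (f * p * e1 + f * p * f).
  by rewrite -!mulrDr ef1 !mulr1 -mulrDl ef1 mul1r.
rewrite !raddfD /=.
rewrite (jordan_corner0 (e := e1)) //; last 2 first.
- by rewrite !mulrA ee.
- by rewrite -!mulrA ee.
rewrite (jordan_off_diagonal0 (e := e1)) //; last 2 first.
- by rewrite !mulrA ee.
- by rewrite -!mulrA fe !mulr0.
rewrite (jordan_off_diagonal0 (e := f)) //; last 2 first.
- by rewrite !mulrA ff.
- by rewrite -!mulrA ef !mulr0.
rewrite (jordan_corner0 (e := f)) ?addr0 //.
- by rewrite !mulrA ff.
- by rewrite -!mulrA ff.
Qed.
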